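(* The LPL and the LD of a surface in the Minkowski 3-space are preserved by the Möbius inversion; that is, if $S\subset\mathbb{R}^3_1$ is a surface and $p\in S\setminus LC$, then $p$ belongs to the $LPL$ of $S$ if and only if $i_M(p)$ belongs to the $LPL$ of the surface $i_M(S\setminus LC)$, and $p$ belongs to the $LD$ of $S$ if and only if $i_M(p)$ belongs to the $LD$ of $i_M(S\setminus LC)$.
   Context: The Minkowski 3-space $\mathbb{R}^3_1$ is $\mathbb{R}^3$ with the pseudo-scalar product $\langle u,v\rangle = u_0v_0+u_1v_1-u_2v_2$. The light cone is $LC=\{p : \langle p,p\rangle=0\}$. The Möbius inversion is the map $i_M:\mathbb{R}^3_1\setminus LC\to\mathbb{R}^3_1\setminus LC$, $i_M(p)=p/\langle p,p\rangle$; it is a diffeomorphism with $i_M^{-1}=i_M$. A surface is a smooth regular surface in $\mathbb{R}^3_1$. For a local parametrization $\mathbf{x}:U\subset\mathbb{R}^2\to\mathbb{R}^3_1$ of a surface, put $E=\langle\mathbf{x}_u,\mathbf{x}_u\rangle$, $F=\langle\mathbf{x}_u,\mathbf{x}_v\rangle$, $G=\langle\mathbf{x}_v,\mathbf{x}_v\rangle$, and $$\bar l=\langle\mathbf{x}_u\times\mathbf{x}_v,\mathbf{x}_{uu}\rangle,\quad \bar m=\langle\mathbf{x}_u\times\mathbf{x}_v,\mathbf{x}_{uv}\rangle,\quad \bar n=\langle\mathbf{x}_u\times\mathbf{x}_v,\mathbf{x}_{vv}\rangle,$$ where $\times$ is the Minkowski cross product, characterized by $\langle a\times b,c\rangle=\det(a,b,c)$.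 The locus of degeneracy $LD$ is the set of points of the surface where the induced metric is degenerate, i.e. points $\mathbf{x}(u,v)$ with $(F^2-EG)(u,v)=0$. The $LPL$ (Lightlike Principal Locus, extended across the $LD$) is the set of points $\mathbf{x}(u,v)$ with $$\left((E\bar n-G\bar l)^2-4(F\bar n-G\bar m)(E\bar m-F\bar l)\right)(u,v)=0,$$ i.e. the discriminant of the binary differential equation $(G\bar m-F\bar n)dv^2+(G\bar l-E\bar n)du\,dv+(F\bar l-E\bar m)du^2=0$ of the lines of principal curvature. *)

(* Defs.v *)
From mathcomp Require Import all_boot all_order all_algebra.
From mathcomp Require Import all_classical all_reals all_analysis.
From mathcomp Require Import ring.
Set Implicit Arguments.
Unset Strict Implicit.
Unset Printing Implicit Defensive.
Import Order.TTheory GRing.Theory Num.Theory.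
Import numFieldNormedType.Exports.
Local Open Scope classical_set_scope.
Local Open Scope ring_scope.

Definition mdot (R : realType) (a b : 'rV[R]_3) : R :=
  a 0 0 * b 0 0 + a 0 1 * b 0 1 - a 0 2 * b 0 2.

Definition mcross (R : realType) (a b : 'rV[R]_3) : 'rV[R]_3 :=
  \row_(j < 3) [:: a 0 1 * b 0 2 - a 0 2 * b 0 1;
                   a 0 2 * b 0 0 - a 0 0 * b 0 2;
                   a 0 1 * b 0 0 - a 0 0 * b 0 1]`_j.

(* mdot is nondegenerate, so this determines mcross a b. *)
Lemma mcrossE (R : realType) (a b c : 'rV[R]_3) :
  mdot (mcross a b) c = \det (\matrix_(i < 3) [:: a; b; c]`_i).
Proof.
rewrite (expand_det_row _ 0) !big_ord_recl big_ord0 /cofactor.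
rewrite !(expand_det_row _ 0) !big_ord_recl !big_ord0 /cofactor !det_mx11.
rewrite !mxE /= /mdot !mxE /=.
have [f fE] : exists f : 'rV[R]_3 -> nat -> R, 
    forall (u : 'rV[R]_3) (i : 'I_3), u 0 i = f u i.
  by exists (fun u n => u 0 (inord n)) => u i; rewrite inord_val.
rewrite !fE /= /bump /= !addn0 !add0n !addn1.
by ring.
Qed.

Definition light_cone (R : realType) : set 'rV[R]_3 := [set p | mdot p p = 0].

(* Outside the light cone this is p / <p, p>; its values on the light cone,
   where the inverse is that of 0, are irrelevant. *)
Definition mobius (R : realType) (p : 'rV[R]_3) : 'rV[R]_3 :=
  (mdot p p)^-1 *: p.

Definition partial (R : realType) (V : normedModType R) (n : nat)
    (i : 'I_n) (f : 'rV[R]_n -> V) : 'rV[R]_n -> V :=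
  fun q => 'D_('e_i) f q.

Fixpoint C_on (R : realType) (V : normedModType R) (n k : nat)
    (U : set 'rV[R]_n) (f : 'rV[R]_n -> V) : Prop :=
  (forall q, U q -> {for q, continuous f}) /\
  if k is k'.+1 then
    forall i : 'I_n,
      (forall q, U q -> derivable f q 'e_i) /\ C_on k' U (partial i f)
  else True.

Definition smooth_on (R : realType) (V : normedModType R) (n : nat)
    (U : set 'rV[R]_n) (f : 'rV[R]_n -> V) : Prop :=
  forall k, C_on k U f.

Section Parametrizations.
Variable R : realType.
Implicit Types (S : set 'rV[R]_3) (U : set 'rV[R]_2) (x : 'rV[R]_2 -> 'rV[R]_3).

Definition x_u x : 'rV[R]_2 -> 'rV[R]_3 := partial 0 x.
Definition x_v x : 'rV[R]_2 -> 'rV[R]_3 := partial 1 x.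

(* A smooth regular parametrization x : U -> S that is a homeomorphism onto an
   open subset of S, with continuous inverse g.  Values of x outside the open
   set U are irrelevant. *)
Definition local_parametrization S U x : Prop :=
  [/\ open U,
      smooth_on U x,
      (forall q, U q -> row_free (col_mx (x_u x q) (x_v x q))) &
      exists (V : set 'rV[R]_3) (g : 'rV[R]_3 -> 'rV[R]_2),
        [/\ open V, x @` U = V `&` S,
            (forall q, U q -> g (x q) = q) &
            {within V `&` S, continuous g}]].

Definition regular_surface S : Prop :=
  forall p, S p -> exists U x, local_parametrization S U x /\ (x @` U) p.

Definition formE x q : R := mdot (x_u x q) (x_u x q).
Definition formF x q : R := mdot (x_u x q) (x_v x q).
Definition formG x q : R := mdot (x_v x q) (x_v x q).

Definition lbar x q : R := mdot (mcross (x_u x q) (x_v x q)) (x_u (x_u x) q).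
Definition mbar x q : R := mdot (mcross (x_u x q) (x_v x q)) (x_v (x_u x) q).
Definition nbar x q : R := mdot (mcross (x_u x q) (x_v x q)) (x_v (x_v x) q).

Definition LD S : set 'rV[R]_3 :=
  [set p | exists U x q, [/\ local_parametrization S U x, U q, x q = p &
    formF x q ^+ 2 - formE x q * formG x q = 0]].

Definition LPL S : set 'rV[R]_3 :=
  [set p | exists U x q, [/\ local_parametrization S U x, U q, x q = p &
    (formE x q * nbar x q - formG x q * lbar x q) ^+ 2
    - 4 * (formF x q * nbar x q - formG x q * mbar x q)
        * (formE x q * mbar x q - formF x q * lbar x q) = 0]].

End Parametrizations.

(* Main.v *)
Require Import Defs.
From mathcomp Require Import all_boot all_order all_algebra.
From mathcomp Require Import all_classical all_reals all_analysis.
From mathcomp Require Import ring.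
Set Implicit Arguments.
Unset Strict Implicit.
Unset Printing Implicit Defensive.
Import Order.TTheory GRing.Theory Num.Theory.
Import numFieldNormedType.Exports.
Local Open Scope classical_set_scope.
Local Open Scope ring_scope.

(* The differential of the inversion at [a] is [<a,a>^-1] times the reflection
   in the plane orthogonal to [a].  Hence the inversion scales E, F, G by a
   common factor (so LD is preserved), and it changes the second fundamental
   form only by a scaling and the addition of a multiple of the first:
     lbar' = k lbar + b E,  mbar' = k mbar + b F,  nbar' = k nbar + b G.
   The discriminant defining the LPL does not see [b].  Since LD and LPL ask for
   some parametrization, it suffices to push one forward; the converse
   implications follow because the inversion is an involution. *)

(** * Directional derivatives of products, linear images and inverses *)

Section DeriveScale.
Variables (R : realType) (V W : normedModType R).

Lemma is_derive_scale (a : V -> R) (f : V -> W) q v (da : R) (df : W) :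
  is_derive q v a da -> is_derive q v f df ->
  is_derive q v (fun r => a r *: f r) (a q *: df + da *: f q).
Proof.
move=> [aP <-] [fP <-].
suff cv : h^-1 *: (((fun r => a r *: f r) \o shift q) (h *: v) - a q *: f q)
    @[h --> 0^'] --> a q *: 'D_v f q + 'D_v a q *: f q.
  by apply: DeriveDef; [apply/cvg_ex; eexists; exact: cv | exact: cvg_lim cv].
have -> : (fun h => h^-1 *:
      (((fun r => a r *: f r) \o shift q) (h *: v) - a q *: f q)) =
    (fun h => a (h *: v + q) *: (h^-1 *: (f (h *: v + q) - f q))
      + (h^-1 * (a (h *: v + q) - a q)) *: f q).
  apply/funext => h /=.
  rewrite scalerA mulrC -!scalerA -scalerDr; congr (_ *: _).
  by rewrite scalerBr scalerBl addrA subrK.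
apply: cvgD; last by apply: cvgZr_tmp; exact: aP.
apply: cvgZ; last exact: fP.
(* Derivability along [v] yields continuity of [a] along the line through [q] in direction [v],
   which is all that this limit needs. *)
have /derivable1P/derivable1_diffP/differentiable_continuous := aP.
by move=> /continuous_withinNx; rewrite scale0r add0r.
Qed.

Lemma is_derive_linear (X : normedModType R) (L : W -> X)
    (f : V -> W) q v (df : W) :
  linear L -> continuous L -> is_derive q v f df -> is_derive q v (L \o f) (L df).
Proof.
move=> Llin Lc [fP <-].
have LB u w : L (u - w) = L u - L w.
  by rewrite addrC -scaleN1r Llin scaleN1r addrC.
have LZ k u : L (k *: u) = k *: L u.
  by rewrite -[k *: u]addr0 Llin -(subrr 0) LB subrr addr0.
suff cv : h^-1 *: ((L \o f \o shift q) (h *: v) - L (f q))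
    @[h --> 0^'] --> L ('D_v f q).
  by apply: DeriveDef; [apply/cvg_ex; eexists; exact: cv | exact: cvg_lim cv].
have -> : (fun h => h^-1 *: ((L \o f \o shift q) (h *: v) - L (f q))) =
    (fun h => L (h^-1 *: ((f \o shift q) (h *: v) - f q))).
  by apply/funext => h; rewrite LZ LB.
exact: (cvg_comp _ _ fP (Lc _)).
Qed.

Lemma is_derive_inv (a : V -> R) q v (da : R) : a q != 0 ->
  is_derive q v a da ->
  is_derive q v (fun r => (a r)^-1) (- (a q)^-1 ^+ 2 * da).
Proof.
move=> a0 [aP <-]; apply: DeriveDef; first exact: derivableV.
by rewrite deriveV// -exprVn.
Qed.

End DeriveScale.

(** * Closure properties of functions of class C^k on an open set *)

Section COn.
Variables (R : realType) (n : nat).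
Implicit Types (V W : normedModType R) (U : set 'rV[R]_n).

Lemma C_on_continuous V k U (f : 'rV[R]_n -> V) :
  C_on k U f -> forall q, U q -> {for q, continuous f}.
Proof. by case: k => [|k] []. Qed.

Lemma C_on_derivable V k U (f : 'rV[R]_n -> V) :
  C_on k.+1 U f -> forall i q, U q -> is_derive q 'e_i f (partial i f q).
Proof. by move=> [_ +] i q Uq => /(_ i)[/(_ _ Uq)/derivableP]. Qed.

Lemma C_on_subset V k U U' (f : 'rV[R]_n -> V) :
  U' `<=` U -> C_on k U f -> C_on k U' f.
Proof.
move=> sU; elim: k f => [|k IH] f /= [fc fd]; split=> [q /sU/fc|]//.
by move=> i; have [d c] := fd i; split=> [q /sU/d|]//; exact: IH.
Qed.

Lemma C_on_pred V k U (f : 'rV[R]_n -> V) : C_on k.+1 U f -> C_on k U f.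
Proof.
elim: k f => [|k IH] f [fc fd]; split=> // i.
by have [d c] := fd i; split=> //; exact: IH.
Qed.

(** Partial derivatives depend on values near the point. As [U] is open, agreement on [U] is
    agreement near each of its points, so it passes to the partial derivatives and the induction
    goes through. *)
Lemma C_on_eq V k U (f g : 'rV[R]_n -> V) :
  open U -> {in U, f =1 g} -> C_on k U f -> C_on k U g.
Proof.
move=> oU; elim: k f g => [|k IH] f g fg fC.
all: have fgn q : U q -> {near q, f =1 g} by move=> Uq;
  apply: filterS (open_nbhs_nbhs (conj oU Uq)) => r Ur; apply: fg; rewrite inE.
all: have gc q : U q -> {for q, continuous g} by move=> Uq;
  rewrite /prop_for /continuous_at -(nbhs_singleton (fgn q Uq));
  apply: cvg_trans (C_on_continuous fC Uq);
  exact: near_eq_cvg (fgn q Uq).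
- by split.
split=> // i; have [_ /(_ i)[d c]] := fC; split=> [q Uq|].
  exact: near_eq_derivable (fgn q Uq) (d q Uq).
apply: IH c => q; rewrite inE => Uq.
exact: near_eq_derive (fgn q Uq).
Qed.

(** The induction step of the closure lemmas below: the partial derivatives may be given by formulas
    [df] that are valid on [U] alone. *)
Lemma C_onS V k U (f : 'rV[R]_n -> V) (df : 'I_n -> 'rV[R]_n -> V) :
  open U -> (forall q, U q -> {for q, continuous f}) ->
  (forall i q, U q -> is_derive q 'e_i f (df i q)) ->
  (forall i, C_on k U (df i)) -> C_on k.+1 U f.
Proof.
move=> oU fc fd dC; split=> // i; split=> [q /(fd i)[]//|].
apply: C_on_eq (dC i) => // q; rewrite inE => /(fd i)[_ <-].
by [].
Qed.

Lemma C_onD V k U (f g : 'rV[R]_n -> V) : open U ->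
  C_on k U f -> C_on k U g -> C_on k U (fun q => f q + g q).
Proof.
move=> oU; elim: k f g => [|k IH] f g fC gC.
all: have c q : U q -> {for q, continuous (fun q => f q + g q)} by move=> Uq;
  exact: continuousD (C_on_continuous fC Uq) (C_on_continuous gC Uq).
- by split.
apply: (@C_onS _ _ _ _ (fun i q => partial i f q + partial i g q)) => //.
  by move=> i q Uq; exact: is_deriveD (C_on_derivable fC i Uq)
    (C_on_derivable gC i Uq).
by move=> i; have [_ /(_ i)[_ ?]] := fC; have [_ /(_ i)[_ ?]] := gC; exact: IH.
Qed.

Lemma C_on_scale V k U (a : 'rV[R]_n -> R) (f : 'rV[R]_n -> V) : open U ->
  C_on k U a -> C_on k U f -> C_on k U (fun q => a q *: f q).
Proof.
move=> oU; elim: k a f => [|k IH] a f aC fC.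
all: have c q : U q -> {for q, continuous (fun q => a q *: f q)} by move=> Uq;
  exact: continuousZ (C_on_continuous aC Uq) (C_on_continuous fC Uq).
- by split.
apply: (@C_onS _ _ _ _
    (fun i q => a q *: partial i f q + partial i a q *: f q)) => //.
  by move=> i q Uq; exact: is_derive_scale (C_on_derivable aC i Uq)
    (C_on_derivable fC i Uq).
move=> i; have [_ /(_ i)[_ ?]] := aC; have [_ /(_ i)[_ ?]] := fC.
(* In each Leibniz term one factor is undifferentiated; its order is lowered to match the other. *)
by apply: C_onD => //; apply: IH => //; exact: C_on_pred.
Qed.

Lemma C_onM k U (a b : 'rV[R]_n -> R) : open U ->
  C_on k U a -> C_on k U b -> C_on k U (fun q => a q * b q).
Proof. exact: C_on_scale. Qed.

Lemma C_on_cst V k U (c : V) : open U -> C_on k U (fun=> c).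
Proof.
move=> oU; elim: k c => [|k IH] c.
  by split=> // q _; exact: cst_continuous.
apply: (@C_onS _ _ _ _ (fun _ _ => 0)) => // q _.
exact: cst_continuous.
Qed.

Lemma C_on_linear V W k U (L : V -> W) (f : 'rV[R]_n -> V) :
  open U -> linear L -> continuous L -> C_on k U f -> C_on k U (L \o f).
Proof.
move=> oU Llin Lc; elim: k f => [|k IH] f fC.
all: have c q : U q -> {for q, continuous (L \o f)} by move=> Uq;
  exact: continuous_comp (C_on_continuous fC Uq) (Lc _).
- by split.
apply: (@C_onS _ _ _ _ (fun i => L \o partial i f)) => //.
  by move=> i q Uq; exact: is_derive_linear Llin Lc (C_on_derivable fC i Uq).
by move=> i; have [_ /(_ i)[_ ?]] := fC; exact: IH.
Qed.

Lemma C_on_inv k U (a : 'rV[R]_n -> R) : open U ->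
  (forall q, U q -> a q != 0) -> C_on k U a -> C_on k U (fun q => (a q)^-1).
Proof.
move=> oU a0; elim: k => [|k IH] aC.
all: have c q : U q -> {for q, continuous (fun q => (a q)^-1)} by move=> Uq;
  exact: continuousV (a0 q Uq) (C_on_continuous aC Uq).
- by split.
(* The derivative of the inverse is written as a product of inverses of [a] and a partial derivative
   of [a], so that [C_onM] and the induction hypothesis apply. *)
apply: (@C_onS _ _ _ _
    (fun i q => -1 * ((a q)^-1 * ((a q)^-1 * partial i a q)))) => //.
  move=> i q Uq.
  apply: is_derive_eq (is_derive_inv (a0 _ Uq) (C_on_derivable aC i Uq)) _.
  by rewrite mulN1r mulrA mulNr expr2.
move=> i; have [_ /(_ i)[_ ?]] := aC.
have ? := IH (C_on_pred aC).
apply: C_onM => //; first exact: C_on_cst.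
by do 2![apply: C_onM => //].
Qed.

End COn.

(** * Algebra of the first and second derivatives of the inversion *)

Section Minkowski.
Variable R : realType.
Implicit Types (a b c u v w p q r : 'rV[R]_3).

Lemma mdotC a b : mdot a b = mdot b a.
Proof. by rewrite /mdot; ring. Qed.

Lemma mdotDl a b c : mdot (a + b) c = mdot a c + mdot b c.
Proof. by rewrite /mdot !mxE; ring. Qed.

Lemma mdotZl (k : R) a b : mdot (k *: a) b = k * mdot a b.
Proof. by rewrite /mdot !mxE; ring. Qed.

Lemma mdotDr a b c : mdot a (b + c) = mdot a b + mdot a c.
Proof. by rewrite /mdot !mxE; ring. Qed.

Lemma mdotZr (k : R) a b : mdot a (k *: b) = k * mdot a b.
Proof. by rewrite /mdot !mxE; ring. Qed.

Lemma mcross_alt a b : mdot (mcross a b) a = 0 /\ mdot (mcross a b) b = 0.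
Proof. by split; rewrite /mdot !mxE /=; ring. Qed.

(** The differential of the inversion at [a], applied to [u]; see [is_derive_mobius]. *)
Definition dmobius a u : 'rV[R]_3 :=
  (mdot a a)^-1 *: u + (-2 * mdot a u * (mdot a a)^-1 ^+ 2) *: a.

Lemma mdot_dmobius a u v : mdot a a != 0 ->
  mdot (dmobius a u) (dmobius a v) = (mdot a a)^-1 ^+ 2 * mdot u v.
Proof.
move=> a0; rewrite /dmobius !mdotDl !mdotDr !mdotZl !mdotZr.
by rewrite [mdot u a]mdotC; field.
Qed.

(** Both sides are determinants by [mcrossE]. A reflection has determinant -1, and the scaling in
    dimension 3 contributes the cube. *)
Lemma det_dmobius a u v w : mdot a a != 0 ->
  mdot (mcross (dmobius a u) (dmobius a v)) (dmobius a w) =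
  - (mdot a a)^-1 ^+ 3 * mdot (mcross u v) w.
Proof.
rewrite /dmobius /mdot !mxE /= => a0; field.
exact: a0.
Qed.

(* The second derivative of the inversion along a surface, where [u], [v] are the
   two first derivatives and [w] is the mixed second one.  In this grouping the
   two middle terms are tangent to the image and drop out of lbar, mbar, nbar. *)
Definition d2mobius a u v w : 'rV[R]_3 :=
  dmobius a w + (-2 * mdot a v * (mdot a a)^-1) *: dmobius a u
  + (-2 * mdot a u * (mdot a a)^-1) *: dmobius a v
  + (-2 * mdot u v * (mdot a a)^-1 ^+ 2) *: a.

(** The normal [N] comes from [u] and [v], while [p] and [q] run over the pairs (u,u), (u,v), (v,v).
    The coefficient of [mdot p q] does not depend on the pair, so lbar, mbar and nbar receive the
    same multiple of E, F and G. *)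
Lemma det_d2mobius a u v p q w : mdot a a != 0 ->
  let N := mcross (dmobius a u) (dmobius a v) in
  mdot N (dmobius a p) = 0 -> mdot N (dmobius a q) = 0 ->
  mdot N (d2mobius a p q w) =
  - (mdot a a)^-1 ^+ 3 * mdot (mcross u v) w
  + (-2 * (mdot a a)^-1 ^+ 2 * mdot N a) * mdot p q.
Proof.
move=> a0 N Np Nq.
have NE b c d e (k l m : R) : mdot N (b + k *: c + l *: d + m *: e) =
    mdot N b + k * mdot N c + l * mdot N d + m * mdot N e.
  by rewrite !mdotDr !mdotZr.
rewrite NE Np Nq [mdot N (dmobius a w)]det_dmobius//.
by ring.
Qed.

Lemma dmobius_eq0 a u : mdot a a != 0 -> dmobius a u = 0 -> u = 0.
Proof.
move=> a0 du0.
have au0 : mdot a u = 0. (* as [mdot a (dmobius a u) = - mdot a u / mdot a a] *)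
  have : mdot a (dmobius a u) = 0 by rewrite du0 /mdot !mxE; ring.
  rewrite /dmobius mdotDr !mdotZr => /(congr1 (fun k => - mdot a a * k)).
  by rewrite mulr0 => <-; field.
have := du0; rewrite /dmobius au0 mulr0 mul0r scale0r addr0.
by move=> /eqP; rewrite scaler_eq0 invr_eq0 (negbTE a0) => /eqP.
Qed.

(** Since [dmobius a] is linear and injective, a linear relation between the images is already one
    between [u] and [v]. *)
Lemma dmobius_row_free a u v : mdot a a != 0 ->
  row_free (col_mx u v) -> row_free (col_mx (dmobius a u) (dmobius a v)).
Proof.
move=> a0 fr; apply: inj_row_free => k.
have kE (y z : 'rV[R]_3) :
    k *m col_mx y z = lsubmx k 0 0 *: y + rsubmx k 0 0 *: z.
  rewrite -[k in LHS]hsubmxK mul_row_col.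
  by rewrite [lsubmx k in LHS]mx11_scalar [rsubmx k in LHS]mx11_scalar
     !mul_scalar_mx.
have -> : k *m col_mx (dmobius a u) (dmobius a v) =
    dmobius a (k *m col_mx u v).
  rewrite !kE /dmobius mdotDr !mdotZr; apply/rowP => j; rewrite !mxE; ring.
move=> /(dmobius_eq0 a0)/eqP; rewrite mulmx_free_eq0// => /eqP.
by [].
Qed.

Lemma mobiusK a : mdot a a != 0 ->
  mdot (mobius a) (mobius a) != 0 /\ mobius (mobius a) = a.
Proof.
move=> a0; have E : mdot (mobius a) (mobius a) = (mdot a a)^-1.
  by rewrite /mobius mdotZl mdotZr; field.
split; first by rewrite E invr_eq0.
by rewrite {1}/mobius E invrK /mobius scalerA divff// scale1r.
Qed.

End Minkowski.

(** * Smoothness and derivatives of the product and of the inversion *)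

Section MinkowskiCalculus.
Variable R : realType.

Lemma continuous_mdot (T : topologicalType) (f g : T -> 'rV[R]_3) t :
  {for t, continuous f} -> {for t, continuous g} ->
  {for t, continuous (fun s => mdot (f s) (g s))}.
Proof.
move=> fc gc.
have c (h : T -> 'rV[R]_3) j : {for t, continuous h} ->
    {for t, continuous (fun s => h s 0 j)}.
  by move=> hc; apply: (@continuous_comp T 'rV[R]_3 R h (fun u => u 0 j) t hc);
    exact: coord_continuous.
apply: continuousB; first apply: continuousD.
all: by apply: continuousM; apply: c.
Qed.

Lemma continuous_mobius (T : topologicalType) (f : T -> 'rV[R]_3) t :
  {for t, continuous f} -> mdot (f t) (f t) != 0 ->
  {for t, continuous (@mobius R \o f)}.
Proof.
move=> fc f0.
pose g s := mdot (f s) (f s).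
have gc : {for t, continuous g} := continuous_mdot fc fc.
exact: (continuousZ (@continuousV R T g t f0 gc) fc).
Qed.

Lemma coord_linear j : linear (fun u : 'rV[R]_3 => u 0 j).
Proof. by move=> k u v; rewrite !mxE. Qed.

Lemma C_on_mdot n k U (f g : 'rV[R]_n -> 'rV[R]_3) : open U ->
  C_on k U f -> C_on k U g -> C_on k U (fun q => mdot (f q) (g q)).
Proof.
move=> oU fC gC.
have c (h : 'rV[R]_n -> 'rV[R]_3) j : C_on k U h -> C_on k U (fun q => h q 0 j).
  apply: (C_on_linear oU (@coord_linear j)); exact: coord_continuous.
apply: C_onD => //; first by apply: C_onD => //; apply: C_onM => //; apply: c.
apply: (@C_on_eq _ _ _ _ _ (fun q => -1 * (f q 0 2 * g q 0 2))) => //.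
  by move=> q _; rewrite mulN1r.
apply: C_onM => //; first exact: C_on_cst.
by apply: C_onM => //; apply: c.
Qed.

Lemma C_on_mobius n k U (f : 'rV[R]_n -> 'rV[R]_3) : open U ->
  (forall q, U q -> mdot (f q) (f q) != 0) ->
  C_on k U f -> C_on k U (@mobius R \o f).
Proof.
by move=> oU f0 fC; apply: C_on_scale => //; apply: C_on_inv => //;
  exact: C_on_mdot.
Qed.

Section Derive.
Variables (V : normedModType R) (q v : V).
Implicit Types (f g : V -> 'rV[R]_3) (df dg : 'rV[R]_3).

Lemma is_derive_mdot f g df dg :
  is_derive q v f df -> is_derive q v g dg ->
  is_derive q v (fun r => mdot (f r) (g r)) (mdot (f q) dg + mdot df (g q)).
Proof.
move=> fd gd.
have c (h : V -> 'rV[R]_3) dh j : is_derive q v h dh ->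
    is_derive q v (fun r => h r 0 j : R) (dh 0 j).
  apply: (is_derive_linear (@coord_linear j)); exact: coord_continuous.
have m j := is_derive_scale (c _ _ j fd) (c _ _ j gd).
apply: is_derive_eq (is_deriveB (is_deriveD (m 0) (m 1)) (m 2)) _.
by rewrite /mdot /GRing.scale/=; ring.
Qed.

Lemma is_derive_mobius f df : mdot (f q) (f q) != 0 ->
  is_derive q v f df -> is_derive q v (@mobius R \o f) (dmobius (f q) df).
Proof.
move=> f0 fd.
pose s r := mdot (f r) (f r).
have sd := @is_derive_inv R V s q v _ f0 (is_derive_mdot fd fd).
apply: is_derive_eq (is_derive_scale sd fd) _.
rewrite /dmobius [mdot df _]mdotC; congr (_ + _ *: _); ring.
Qed.

(** Base point and vector both vary: with [f] a parametrization and [g] one of its partial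
    derivatives, this gives the second derivatives of the inverted surface. *)
Lemma is_derive_dmobius f g df dg : mdot (f q) (f q) != 0 ->
  is_derive q v f df -> is_derive q v g dg ->
  is_derive q v (fun r => dmobius (f r) (g r)) (d2mobius (f q) (g q) df dg).
Proof.
move=> f0 fd gd.
pose s r := mdot (f r) (f r).
have sd := @is_derive_inv R V s q v _ f0 (is_derive_mdot fd fd).
have cd := is_derive_scale (is_derive_scale (is_derive_cst (-2 : R) q v)
  (is_derive_mdot fd gd)) (is_derive_scale sd sd).
apply: is_derive_eq
  (is_deriveD (is_derive_scale sd gd) (is_derive_scale cd fd)) _.
rewrite /d2mobius /dmobius [mdot df (f q)]mdotC [mdot df (g q)]mdotC.
apply/rowP => j; rewrite !mxE /GRing.scale/= /s/= /cst/=; field.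
exact: f0.
Qed.

End Derive.

End MinkowskiCalculus.


(** Meant for the inverse of an inverted chart: the inner map is the inversion, continuous off the
    cone, and the outer one is the old inverse chart, continuous only within a piece of the
    surface. *)
Lemma within_continuous_comp_in (T1 T2 T3 : topologicalType)
    (A : set T1) (B : set T2) (f : T1 -> T2) (g : T2 -> T3) :
  (forall t, A t -> B (f t)) -> (forall t, A t -> {for t, continuous f}) ->
  {within B, continuous g} -> {within A, continuous (g \o f)}.
Proof.
move=> AB fc /subspace_continuousP gc; apply/subspace_continuousP => t At.
apply: (cvg_comp f g _ (gc _ (AB t At))) => D HD.
have H : nbhs t (f @^-1` [set r | B r -> D r]) := fc t At _ HD.
suff : nbhs t [set r | A r -> D (f r)] by [].
by apply: filterS H => r rD Ar; apply: rD; exact: AB.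
Qed.

(** * The inverted surface and its parametrizations *)

Section Transfer.
Variable R : realType.
Implicit Types (S : set 'rV[R]_3) (U : set 'rV[R]_2) (x : 'rV[R]_2 -> 'rV[R]_3).

Definition mobius_image S : set 'rV[R]_3 :=
  @mobius R @` (S `\` @light_cone R).

Definition off_cone U x : set 'rV[R]_2 :=
  U `&` [set q | mdot (x q) (x q) != 0].

Lemma near_mdot_neq0 (T : topologicalType) (f : T -> 'rV[R]_3) t :
  {for t, continuous f} -> mdot (f t) (f t) != 0 ->
  \forall s \near t, mdot (f s) (f s) != 0.
Proof.
pose g s := mdot (f s) (f s).
move=> fc f0; have gc : {for t, continuous g} := continuous_mdot fc fc.
exact: (@cvgr_neq0 _ _ _ _ _ g (g t) gc f0).
Qed.

Lemma open_off_cone U x : open U -> (forall q, U q -> {for q, continuous x}) ->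
  open (off_cone U x).
Proof.
move=> oU xc; rewrite openE => q [Uq xq]; apply: filterI.
  exact: open_nbhs_nbhs (conj oU Uq).
exact: near_mdot_neq0 (xc q Uq) xq.
Qed.

Lemma mobius_imageP S p : mobius_image S p ->
  [/\ mdot p p != 0, S (mobius p) & mdot (mobius p) (mobius p) != 0].
Proof.
move=> [r [Sr /eqP r0] <-]; have [mr0 mrK] := mobiusK r0.
by rewrite mrK; split.
Qed.

Lemma mobius_image_mobius S p : S p -> mdot p p != 0 ->
  mobius_image S (mobius p).
Proof. by move=> Sp /eqP p0; exists p. Qed.

(** On surfaces the inversion is an involution only up to removal of the light cone;
    [local_parametrization_setD] bridges this difference. *)
Lemma mobius_imageK S : mobius_image (mobius_image S) = S `\` @light_cone R.
Proof.
apply/seteqP; split=> p.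
  move=> /mobius_imageP[p0 /mobius_imageP[_ + _] _].
  by have [_ ->] := mobiusK p0; split=> //; exact/eqP.
move=> [Sp /eqP p0]; have [mp0 mpK] := mobiusK p0.
rewrite -mpK; apply: mobius_image_mobius => //; exact: mobius_image_mobius.
Qed.

(** The complement of the cone is open, so it can be absorbed into the ambient open set [V]; the
    chart and its inverse stay the same. *)
Lemma local_parametrization_setD S U x :
  local_parametrization (S `\` @light_cone R) U x -> local_parametrization S U x.
Proof.
move=> [oU xs xr [V [g [oV xV gx gc]]]]; split=> //.
have E : (V `&` [set p | mdot p p != 0]) `&` S = V `&` (S `\` @light_cone R).
  apply/seteqP; split=> p [].
    by move=> [Vp /eqP p0] Sp.
  by move=> Vp [Sp /eqP p0].
exists (V `&` [set p | mdot p p != 0]), g; rewrite E; split=> //.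
rewrite openE => p [Vp p0]; apply: filterI.
  exact: open_nbhs_nbhs (conj oV Vp).
apply: (@near_mdot_neq0 _ id) => //; exact: cvg_id.
Qed.

(** * Pushing a parametrization forward by the inversion *)

Section Pushforward.
Variables (S : set 'rV[R]_3) (U : set 'rV[R]_2) (x : 'rV[R]_2 -> 'rV[R]_3).
Hypothesis xP : local_parametrization S U x.
Let y : 'rV[R]_2 -> 'rV[R]_3 := @mobius R \o x.

Let oU : open (off_cone U x).
Proof.
have [oU xs _ _] := xP; apply: open_off_cone => // q.
exact: C_on_continuous (xs 0%N) q.
Qed.

Let xC k : C_on k (off_cone U x) x.
Proof. by have [_ xs _ _] := xP; apply: C_on_subset (xs k) => q []. Qed.

Lemma partial_mobius i q : off_cone U x q ->
  partial i y q = dmobius (x q) (partial i x q).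
Proof.
move=> Uq; have [_ xq] := Uq.
by have [_ <-] := is_derive_mobius xq (C_on_derivable (xC 1%N) i Uq).
Qed.

Lemma partial2_mobius i j q : off_cone U x q ->
  partial j (partial i y) q =
  d2mobius (x q) (partial i x q) (partial j x q) (partial j (partial i x) q).
Proof.
move=> Uq; have [_ xq] := Uq.
have pC : C_on 1 (off_cone U x) (partial i x) := ((xC 2%N).2 i).2.
have [_ <-] := is_derive_dmobius xq (C_on_derivable (xC 1%N) j Uq)
  (C_on_derivable pC j Uq).
(* The formula for the first derivative may be differentiated because it holds on the whole open set
   [off_cone U x]. *)
apply: near_eq_derive; apply: filterS (open_nbhs_nbhs (conj oU Uq)) => r.
exact: partial_mobius.
Qed.

Lemma local_parametrization_mobius :
  local_parametrization (mobius_image S) (off_cone U x) y.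
Proof.
have [_ _ xr [V [g [oV xV gx gc]]]] := xP; split=> //.
- by move=> k; apply: C_on_mobius => // q [].
- move=> q Uq; rewrite /x_u /x_v !partial_mobius//.
  by case: Uq => Uq xq; apply: dmobius_row_free => //; exact: xr.
(* The inversion is its own inverse off the cone, so [V'] is the image of the off-cone part of [V],
   and [g \o mobius] inverts the new chart. The points of the cone, where [mobius] takes the default
   value 0, are excluded. *)
pose V' := [set p : 'rV[R]_3 | mdot p p != 0 /\ V (mobius p)].
have mc (p : 'rV[R]_3) : mdot p p != 0 -> {for p, continuous (@mobius R)}.
  by apply: (@continuous_mobius R _ id p); exact: cvg_id.
exists V', (g \o @mobius R); split.
- rewrite openE => p [p0 Vp]; apply: filterI.
    by apply: (@near_mdot_neq0 _ id) => //; exact: cvg_id.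
  exact: mc p0 _ (open_nbhs_nbhs (conj oV Vp)).
- apply/seteqP; split=> p.
    move=> [q [Uq xq] <-]; have [yq yK] := mobiusK xq.
    have [Vx Sx] : (V `&` S) (x q) by rewrite -xV; exists q.
    by split; [rewrite /V' /= yK|exact: mobius_image_mobius].
  move=> [[p0 Vp] /mobius_imageP[_ Sp mp0]].
  have : (V `&` S) (mobius p) by [].
  rewrite -xV => -[q Uq qE]; exists q; first by split; rewrite //= qE.
  by rewrite /y /= qE; have [_ ->] := mobiusK p0.
- by move=> q [Uq xq]; rewrite /y /=; have [_ ->] := mobiusK xq; exact: gx.
apply: (within_continuous_comp_in (B := V `&` S)) gc => p.
  by move=> [[p0 Vp] /mobius_imageP[_ Sp _]].
by move=> [[p0 _] _]; exact: mc.
Qed.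

Lemma forms_mobius q : off_cone U x q ->
  let t := (mdot (x q) (x q))^-1 in
  [/\ formE y q = t ^+ 2 * formE x q, formF y q = t ^+ 2 * formF x q &
     formG y q = t ^+ 2 * formG x q].
Proof.
move=> Uq; rewrite /formE /formF /formG /x_u /x_v !partial_mobius//.
by split; apply: mdot_dmobius; case: Uq.
Qed.

Lemma bar_mobius q : off_cone U x q ->
  let t := (mdot (x q) (x q))^-1 in
  exists b : R,
  [/\ lbar y q = - t ^+ 3 * lbar x q + b * formE x q,
     mbar y q = - t ^+ 3 * mbar x q + b * formF x q &
     nbar y q = - t ^+ 3 * nbar x q + b * formG x q].
Proof.
move=> Uq t; have [_ xq] := Uq; have pE i := partial_mobius i Uq.
have [Nu Nv] := mcross_alt (dmobius (x q) (partial 0 x q))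
  (dmobius (x q) (partial 1 x q)).
(* This is the coefficient of [mdot p q] in [det_d2mobius]. *)
exists (-2 * t ^+ 2 * mdot (mcross (dmobius (x q) (partial 0 x q))
  (dmobius (x q) (partial 1 x q))) (x q)).
rewrite /lbar /mbar /nbar /formE /formF /formG /x_u /x_v !pE.
by split; rewrite partial2_mobius ?det_d2mobius.
Qed.

End Pushforward.

(** * Transfer of the LD and the LPL *)

Lemma LD_mobius S p : LD S p -> mdot p p != 0 ->
  LD (mobius_image S) (mobius p).
Proof.
move=> [U [x [q [xP Uq <- D0]]]] xq.
exists (off_cone U x), (@mobius R \o x), q.
split; [exact: local_parametrization_mobius | by [] | by [] |].
have [-> -> ->] := forms_mobius xP (conj Uq xq).
transitivity ((mdot (x q) (x q))^-1 ^+ 4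
  * (formF x q ^+ 2 - formE x q * formG x q)); first by ring.
by rewrite D0 mulr0.
Qed.

Lemma LPL_mobius S p : LPL S p -> mdot p p != 0 ->
  LPL (mobius_image S) (mobius p).
Proof.
move=> [U [x [q [xP Uq <- D0]]]] xq.
exists (off_cone U x), (@mobius R \o x), q.
split; [exact: local_parametrization_mobius | by [] | by [] |].
have [-> -> ->] := forms_mobius xP (conj Uq xq).
have [b [-> -> ->]] := bar_mobius xP (conj Uq xq).
set t := (mdot (x q) (x q))^-1.
(* In each of the three differences the terms with [b] cancel and the rest is scaled by [- t ^+ 5];
   the discriminant is quadratic in them. *)
transitivity (t ^+ 10 * ((formE x q * nbar x q - formG x q * lbar x q) ^+ 2
  - 4 * (formF x q * nbar x q - formG x q * mbar x q)
      * (formE x q * mbar x q - formF x q * lbar x q))); first by ring.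
by rewrite D0 mulr0.
Qed.

Lemma LD_setD S p : LD (S `\` @light_cone R) p -> LD S p.
Proof.
move=> [U [x [q [/local_parametrization_setD xP Uq pE D0]]]].
by exists U, x, q.
Qed.

Lemma LPL_setD S p : LPL (S `\` @light_cone R) p -> LPL S p.
Proof.
move=> [U [x [q [/local_parametrization_setD xP Uq pE D0]]]].
by exists U, x, q.
Qed.

Lemma regular_surface_mobius S :
  regular_surface S -> regular_surface (mobius_image S).
Proof.
move=> hS _ [p [Sp /eqP p0] <-]; have [U [x [xP [q Uq qp]]]] := hS p Sp.
exists (off_cone U x), (@mobius R \o x); split.
  exact: local_parametrization_mobius.
by exists q; [split; rewrite //= qp|rewrite /= qp].
Qed.

End Transfer.

Theorem corollary3p3 (R : realType) (S : set 'rV[R]_3) (hS : regular_surface S) :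
  let S' := @mobius R @` (S `\` @light_cone R) in
  regular_surface S' /\
  forall p : 'rV[R]_3, S p -> ~ light_cone p ->
    (LPL S p <-> LPL S' (mobius p)) /\ (LD S p <-> LD S' (mobius p)).
Proof.
move=> S'; split; first exact: regular_surface_mobius.
move=> p Sp /eqP p0; have [mp0 mpK] := mobiusK p0.
have S'K := mobius_imageK S.
split; split=> [pS|pS'].
- exact: LPL_mobius.
(* The forward implication is applied to the surface [S'] at the point [mobius p]: inverting again
   gives back [p] and [S] without the cone. *)
- by apply: LPL_setD; rewrite -S'K -mpK; exact: LPL_mobius.
- exact: LD_mobius.
- by apply: LD_setD; rewrite -S'K -mpK; exact: LD_mobius.
Qed.
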